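(* Assume that $X$ is a convex, closed and non-empty subset of $\mathbb{R}^n=\prod_{\nu\in N}\mathbb{R}^{n_\nu}$, and that for each $\nu\in N$ the objective function $\theta_\nu:\mathbb{R}^n\to\mathbb{R}$ is pseudo-continuous. Suppose there exists $\rho>0$ such that (i) $X\cap\overline{B}_\rho\ne\emptyset$, and (ii) for each $x\in X$ with $\|x\|=\rho$ there exists $y\in\mathcal{X}(x)$ such that $(y^\nu,x^{-\nu})\in B_\rho$ and $\theta_\nu(y^\nu,x^{-\nu})\le\theta_\nu(x)$ for all $\nu\in N$. If each $\theta_\nu$ is semi strictly quasi-convex with respect to its player's variable, then the set $\mathrm{RGNEP}(\{\theta_\nu,X\}_{\nu\in N})$ is non-empty.
   Context: $N$ is a finite non-empty set of players. For $x\in\mathbb{R}^n$, write $x=(x^\nu,x^{-\nu})$, where $x^\nu\in\mathbb{R}^{n_\nu}$ is the component of player $\nu$ and $x^{-\nu}$ collects the components of the other players. $\|\cdot\|$ is a norm on $\mathbb{R}^n$, $B_\rho=\{x:\|x\|<\rho\}$ and $\overline{B}_\rho=\{x:\|x\|\le\rho\}$. $X_\nu(x^{-\nu}):=\{x^\nu\in\mathbb{R}^{n_\nu}:(x^\nu,x^{-\nu})\in X\}$ and $\mathcal{X}(x):=\prod_{\nu\in N}X_\nu(x^{-\nu})$. $\mathrm{RGNEP}(\{\theta_\nu,X\}_{\nu\in N})$ is the set of generalized Nash equilibria of Rosen's game: all $\hat x\in X$ such that for every $\nu\in N$ and every $x^\nu\in\mathbb{R}^{n_\nu}$ with $(x^\nu,\hat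 x^{-\nu})\in X$ one has $\theta_\nu(\hat x)\le\theta_\nu(x^\nu,\hat x^{-\nu})$. A function $f:\mathbb{R}^n\to\mathbb{R}$ is upper pseudo-continuous if for any $x,y\in\mathbb{R}^n$ with $f(x)<f(y)$ there is a neighbourhood $V_x$ of $x$ such that $f(x')<f(y)$ for all $x'\in V_x$; it is lower pseudo-continuous if $-f$ is upper pseudo-continuous; it is pseudo-continuous if it is both. A function $f$ is quasi-convex if $f(tx+(1-t)y)\le\max\{f(x),f(y)\}$ for all $x,y$ and $t\in[0,1]$; it is semi strictly quasi-convex if it is quasi-convex and moreover, for all $x,y$ with $f(x)<f(y)$, $f(tx+(1-t)y)<f(y)$ for all $t\in\,]0,1[$. ''With respect to its player's variable'' means that the property holds for $\theta_\nu(\cdot,x^{-\nu}):\mathbb{R}^{n_\nu}\to\mathbb{R}$ for every $x^{-\nu}$. *)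

(* Defs.v *)
From HB Require Import structures.
From mathcomp Require Import all_boot all_order all_algebra.
From mathcomp Require Import all_classical all_reals all_analysis.

Set Implicit Arguments.
Unset Strict Implicit.
Unset Printing Implicit Defensive.

Import Order.TTheory GRing.Theory Num.Theory.
Import numFieldNormedType.Exports.

Local Open Scope classical_set_scope.
Local Open Scope ring_scope.

(* R^n as the product of the R^(d nu): the component of player nu is [x nu].
   The topology is the product topology, which is that of any norm on R^n;
   the vector space structure, defined componentwise below, is not provided by
   the library for dependent products. *)
Definition profile (R : realType) (N : finType) (d : N -> nat) : Type :=
  prod_topology (fun nu : N => 'rV[R]_(d nu)).

HB.instance Definition _ (R : realType) (N : finType) (d : N -> nat) :=
  Uniform.copy (profile R d) (prod_topology (fun nu : N => 'rV[R]_(d nu))).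

Section profile_lmodType.
Context (R : realType) (N : finType) (d : N -> nat).
Implicit Types (x y z : profile R d) (a b : R).

Definition profile0 : profile R d := fun=> 0.
Definition profile_opp x : profile R d := fun nu => - x nu.
Definition profile_add x y : profile R d := fun nu => x nu + y nu.
Definition profile_scale a x : profile R d := fun nu => a *: x nu.

Fact profile_addA : associative profile_add.
Proof. by move=> x y z; apply: functional_extensionality_dep => nu; exact: addrA. Qed.

Fact profile_addC : commutative profile_add.
Proof. by move=> x y; apply: functional_extensionality_dep => nu; exact: addrC. Qed.

Fact profile_add0 : left_id profile0 profile_add.
Proof. by move=> x; apply: functional_extensionality_dep => nu; exact: add0r. Qed.

Fact profile_addN : left_inverse profile0 profile_opp profile_add.
Proof. by move=> x; apply: functional_extensionality_dep => nu; exact: addNr. Qed.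

HB.instance Definition _ := GRing.isZmodule.Build (profile R d)
  profile_addA profile_addC profile_add0 profile_addN.

Fact profile_scaleA a b x :
  profile_scale a (profile_scale b x) = profile_scale (a * b) x.
Proof. by apply: functional_extensionality_dep => nu; exact: scalerA. Qed.

Fact profile_scale1 : left_id 1 profile_scale.
Proof. by move=> x; apply: functional_extensionality_dep => nu; exact: scale1r. Qed.

Fact profile_scaleDr : right_distributive profile_scale +%R.
Proof. by move=> a x y; apply: functional_extensionality_dep => nu; exact: scalerDr. Qed.

Fact profile_scaleDl x : {morph profile_scale^~ x : a b / a + b}.
Proof. by move=> a b; apply: functional_extensionality_dep => nu; exact: scalerDl. Qed.

HB.instance Definition _ := GRing.Zmodule_isLmodule.Build R (profile R d)
  profile_scaleA profile_scale1 profile_scaleDr profile_scaleDl.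

End profile_lmodType.

Record is_norm (R : realType) (E : lmodType R) (nrm : E -> R) : Prop := IsNorm {
  is_norm_eq0 : forall x, nrm x = 0 -> x = 0 ;
  is_normZ : forall a x, nrm (a *: x) = `|a| * nrm x ;
  is_norm_triangle : forall x y, nrm (x + y) <= nrm x + nrm y }.

Definition oball (R : realType) (E : lmodType R) (nrm : E -> R) (rho : R) : set E :=
  [set x | nrm x < rho].

Definition cball (R : realType) (E : lmodType R) (nrm : E -> R) (rho : R) : set E :=
  [set x | nrm x <= rho].

Definition upper_pseudo_continuous (R : realType) (T : topologicalType)
    (f : T -> R) : Prop :=
  forall x y, f x < f y -> \forall x' \near x, f x' < f y.

Definition lower_pseudo_continuous (R : realType) (T : topologicalType)
    (f : T -> R) : Prop :=
  upper_pseudo_continuous (fun x => - f x).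

Definition pseudo_continuous (R : realType) (T : topologicalType)
    (f : T -> R) : Prop :=
  upper_pseudo_continuous f /\ lower_pseudo_continuous f.

Definition quasi_convex (R : realType) (E : lmodType R) (f : E -> R) : Prop :=
  forall x y (t : R), 0 <= t <= 1 ->
    f (t *: x + (1 - t) *: y) <= Num.max (f x) (f y).

Definition semistrictly_quasi_convex (R : realType) (E : lmodType R)
    (f : E -> R) : Prop :=
  quasi_convex f /\
  forall x y, f x < f y -> forall t : R, 0 < t < 1 ->
    f (t *: x + (1 - t) *: y) < f y.

(* [deviate x nu y] is the point (y, x^{-nu}); it does not depend on [x nu]. *)
Definition deviate (R : realType) (N : finType) (d : N -> nat)
    (x : profile R d) (nu : N) (y : 'rV[R]_(d nu)) : profile R d :=
  dfwith x nu y.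

Definition own_semistrictly_quasi_convex (R : realType) (N : finType)
    (d : N -> nat) (nu : N) (f : profile R d -> R) : Prop :=
  forall x : profile R d,
    semistrictly_quasi_convex (fun y : 'rV[R]_(d nu) => f (deviate x y)).

(* X_nu(x^{-nu}) *)
Definition strategy_set (R : realType) (N : finType) (d : N -> nat)
    (X : set (profile R d)) (nu : N) (x : profile R d) : set 'rV[R]_(d nu) :=
  [set y | X (deviate x y)].

(* The product of the X_nu(x^{-nu}), which need not be contained in X. *)
Definition strategy_product (R : realType) (N : finType) (d : N -> nat)
    (X : set (profile R d)) (x : profile R d) : set (profile R d) :=
  [set y | forall nu : N, strategy_set X x (y nu)].

Definition RGNEP (R : realType) (N : finType) (d : N -> nat)
    (theta : N -> profile R d -> R) (X : set (profile R d)) :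
    set (profile R d) :=
  [set x | X x /\ forall (nu : N) (y : 'rV[R]_(d nu)),
    X (deviate x y) -> theta nu x <= theta nu (deviate x y)].

(* Main.v *)
Require Import Defs.
From HB Require Import structures.
From mathcomp Require Import all_boot all_order all_algebra.
From mathcomp Require Import all_classical all_reals all_analysis.
From mathcomp Require Import zify ring lra.

Set Implicit Arguments.
Unset Strict Implicit.
Unset Printing Implicit Defensive.

(** Why the theorem is true.

Let [K] be the intersection of [X] with the closed ball of radius [rho]; it is
convex, non-empty and compact (all norms are equivalent in finite dimension).

An equilibrium [x] of the game restricted to [K] is an equilibrium of the whole
game ([theorem5p2]).  Each player [nu] has a strategy [w], available against
[x], which keeps the profile in the open ball and costs no more than [x nu]:
take [w := x nu] if [x] is inside the ball, and hypothesis (ii) on the sphere.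
If some available [z] were strictly better than [x nu], semi strict
quasi-convexity would make the points of the open segment from [w] to [z]
strictly better too, and those close to [w] are still in [K].

So everything rests on the compact case [equilibrium_compact], where only
quasi-convexity in the own variable is used.  As the constraint [K] is shared,
the best response of a player does not depend lower semicontinuously on the
others, so Kakutani's theorem does not apply to best responses.  The classical
detour is a variational inequality: find [x] in [K] and, for each player, a
nonzero normal vector to the set of strictly better strategies at [x nu], such
that the sum over the players of the pairings of these vectors with
[y nu - x nu] is nonnegative for all [y] in [K].  Here the dual vectors are
eliminated.  A relation [improves x y] expresses that [y - x] is, summed over
the players, a direction of strict improvement; it is open in [x], convex in
[y], irreflexive, and contains every strictly better deviation of a single
player.  By the Ky Fan - Browder theorem ([maximal_element]) some [x] in [K] is
improved by no [y] in [K], and this [x] is an equilibrium.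

The Ky Fan - Browder theorem is reduced to a covering property of the simplex
([simplex_cover]): if the interiors of sets [U i] cover the simplex, some point
lies in [U i] for each of its positive coordinates [i].  That property, which
is equivalent to Brouwer's theorem, comes from a parity argument of Scarf.  For
a finite set with several linear orders, the dominant subsets behave like the
simplices of a triangulated sphere: a subset with one element less than the
number of orders has exactly two dominant extensions ([card_extension]).
Sperner's counting then gives a dominant subset carrying all the colours
([rainbow_dominant]).  When the orders are those of the coordinates on the grid
points of a simplex, a dominant subset is a cluster of neighbouring points close
to one face ([grid_cover]), so no triangulation is ever needed. *)

(** * Dominant subsets for several linear orders *)

Section Dominance.
Import boot.fintype boot.finset.
Variables (U I : finType) (r : I -> U -> nat).
Hypothesis r_inj : forall i, injective (r i).

Definition dominant (b : {set U}) : bool :=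
  [forall v, exists i, forall x in b, r i v <= r i x].

Lemma dominantP (b : {set U}) :
  reflect (forall v, exists i, forall x, x \in b -> r i v <= r i x)
    (dominant b).
Proof.
apply: (iffP forallP) => h v; have := h v.
  by move=> /existsP[i /forall_inP hi]; exists i.
by move=> [i hi]; apply/existsP; exists i; apply/forall_inP.
Qed.

Lemma dominantS (a b : {set U}) : a \subset b -> dominant b -> dominant a.
Proof.
move=> /subsetP ab /dominantP db; apply/dominantP => v.
by have [i hi] := db v; exists i => x /ab /hi.
Qed.

(** If two orders [a] and [a'] have the same minimum on [g], dropping [a]
leaves every element of [g] the minimum of some order.  The new element must
then be above the minima of all the orders but [a]; among such elements only
the largest for [a] keeps the set dominant. *)
Lemma extension_at (g : {set U}) (m : I -> U) (a a' : I) :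
    dominant g -> (forall i, m i \in g) ->
    (forall i x, x \in g -> r i (m i) <= r i x) ->
    (forall x, x \in g -> exists i, m i = x) ->
    a != a' -> m a = m a' ->
    (exists v, forall i, i != a -> r i (m i) < r i v) ->
  exists x, [/\ x \notin g, dominant (x |: g), r a x < r a (m a),
    forall i, i != a -> r i (m i) < r i x &
    forall v, (forall i, i != a -> r i (m i) < r i v) -> r a v <= r a x].
Proof.
move=> /dominantP dg mg mmin msurj aa' maa' [v0 hv0].
pose M := [pred v | [forall i, (i != a) ==> (r i (m i) < r i v)]].
have MP v : reflect (forall i, i != a -> r i (m i) < r i v) (M v).
  by apply: (iffP forall_inP).
have [x /MP Mx xmax] : exists2 x, M x & forall v, M v -> r a v <= r a x.
  have Mv0 : M v0 by apply/MP.
  by exists [arg max_(v > v0 | M v) r a v];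
    case: arg_maxnP => // x Mx h // v /h.
have xg : x \notin g.
  apply/negP => /msurj[i mix]; have [ia|/Mx] := eqVneq i a; last first.
    by rewrite mix ltnn.
  by have := Mx a'; rewrite eq_sym aa' -maa' -ia mix ltnn => /(_ isT).
have xa : r a x < r a (m a).
  have [i hi] := dg x; have [ia|/Mx] := eqVneq i a; last first.
    by have := hi _ (mg i); lia.
  rewrite ltn_neqAle -ia hi ?mg// andbT; apply/eqP => /r_inj xm.
  by rewrite xm mg in xg.
exists x; split=> //; last by move=> v /MP; exact: xmax.
apply/dominantP => v; have [Mv|] := boolP (M v).
  exists a => y; rewrite !inE => /orP[/eqP->|yg]; first exact: xmax.
  by have := xmax _ Mv; have := mmin a y yg; lia.
rewrite negb_forall => /existsP[i]; rewrite negb_imply -leqNgt => /andP[ia vi].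
exists i => y; rewrite !inE => /orP[/eqP->|yg].
  by have := Mx _ ia; lia.
by have := mmin i y yg; lia.
Qed.

(** The pseudomanifold property.  By dominance each element of [g] is the
minimum of some order.  There is one order more than elements, so exactly one
pair [a], [b] of orders shares its minimum, and the new element takes over the
minimum of either [a] or [b]: one extension for each.  The last hypothesis says
that room is left above [g] for whichever orders happen to be that pair. *)
Lemma card_extension (g : {set U}) (t : U) :
    t \in g -> #|g|.+1 = #|I| -> dominant g ->
    (forall a b y, a != b -> y \in g ->
       (forall x, x \in g -> r a y <= r a x /\ r b y <= r b x) ->
     exists v, forall i, i != a -> exists2 x, x \in g & r i x < r i v) ->
  #|[set x | (x \notin g) && dominant (x |: g)]| = 2.
Proof.
move=> tg cg dg hext; have /dominantP dgP := dg.
pose m i := [arg min_(x < t in g) r i x].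
have mg i : m i \in g by rewrite /m; case: arg_minnP.
have mmin i x : x \in g -> r i (m i) <= r i x.
  by rewrite /m; case: arg_minnP => // y _ h /h.
have meq i x : x \in g -> (forall y, y \in g -> r i x <= r i y) -> m i = x.
  by move=> xg hx; apply: (r_inj (i := i)); apply/eqP; rewrite eqn_leq mmin ?hx.
have msurj x : x \in g -> exists i, m i = x.
  by move=> xg; have [i hi] := dgP x; exists i; exact: meq.
have [a [b ab mab]] : exists a, exists2 b, a != b & m a = m b.
  apply/injectivePn/negP => /injectiveP minj.
  have : #|m @: [set: I]| <= #|g|.
    by apply/subset_leq_card/subsetP => _ /imsetP[i _ ->].
  by rewrite card_imset // cardsT -cg ltnn.
(* Off one member of a colliding pair the minima still exhaust [g], with
   exactly as many orders as elements, hence without further collision. *)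
have inj_off c c' : c != c' -> m c = m c' -> {in [set~ c] &, injective m}.
  move=> cc' mcc'; apply/imset_injP; rewrite cardsC1 -cg /=.
  apply/eqP/eq_card => x; apply/imsetP/idP => [[i _ ->]//|/msurj[i <-]].
  have [->|ic] := eqVneq i c; last by exists i; rewrite ?inE.
  by exists c'; rewrite ?inE // eq_sym.
have excl i j : m i = m j -> i != j -> (i == a) || (i == b).
  move=> mij ij; have [//|ia /=] := eqVneq i a; apply: contraT => ib.
  have [ja|ja] := eqVneq j a.
    have := inj_off b a; rewrite eq_sym ab mab => /(_ isT erefl i j).
    by rewrite !inE ib ja ab => /(_ isT isT); rewrite -ja => /(_ mij) /eqP;
      rewrite (negPf ij).
  have := inj_off a b ab mab i j; rewrite !inE ia ja => /(_ isT isT mij) /eqP.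
  by rewrite (negPf ij).
have hext' p q : p != q -> m p = m q ->
    exists v, forall i, i != p -> r i (m i) < r i v.
  move=> pq mpq; have [//|x xg|v hv] := hext p q (m p) pq.
    by split; [|rewrite mpq]; exact: mmin.
  by exists v => i /hv[x xg]; exact: leq_ltn_trans (mmin i x xg).
have [xa [xag xad xalt xaM xamax]] :=
  extension_at dg mg mmin msurj ab mab (hext' a b ab mab).
have [xb [xbg xbd xblt xbM xbmax]] : exists x, [/\ x \notin g,
    dominant (x |: g), r b x < r b (m b), forall i, i != b -> r i (m i) < r i x &
    forall v, (forall i, i != b -> r i (m i) < r i v) -> r b v <= r b x].
  by apply: (@extension_at _ _ _ a) => //; try apply: (hext' b a);
    rewrite // eq_sym.
have xab : xa != xb.
  apply/eqP => e; have := xbM a ab; rewrite -e; lia.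
rewrite -[RHS](_ : #|[set xa; xb]| = 2); last by rewrite cards2 xab.
apply/eq_card => x; rewrite !inE; apply/idP/idP; last first.
  by case/orP=> /eqP->; rewrite ?xag ?xbg.
case/andP=> xg /dominantP dx.
have neq i y : y \in g -> r i x != r i y.
  by move=> yg; apply: contraNneq xg => /r_inj->.
(* Adding [x] must not evict an element of [g] from all its minima. *)
have key y : y \in g -> exists2 k, m k = y & r k y < r k x.
  move=> yg; have [k hk] := dx y; exists k.
    by apply: meq => // z zg; apply: hk; rewrite !inE zg orbT.
  by rewrite ltn_neqAle eq_sym neq // hk // !inE eqxx.
have [i hi] := dx x.
have ilt : r i x < r i (m i).
  by rewrite ltn_neqAle neq ?mg //= hi // !inE mg orbT.
have [k mk klt] := key _ (mg i).
have ki : k != i by apply/eqP => e; rewrite e in klt; lia.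
have Mx j : j != i -> r j (m j) < r j x.
  move=> ji; have [k' mk' k'lt] := key _ (mg j).
  have [<-|k'j] := eqVneq k' j; first by rewrite mk'.
  have jab : (j == a) || (j == b) by apply: (excl j k') => //; rewrite eq_sym.
  have iab : (i == a) || (i == b) by apply: (excl i k) => //; rewrite eq_sym.
  have kab : (k == a) || (k == b) by apply: (excl k i).
  have <- : k = j.
    move: ki ji; case/orP: iab => /eqP->; case/orP: jab => /eqP->;
      by case/orP: kab => /eqP->; rewrite ?eqxx.
  by rewrite mk.
have xmax v : (forall j, j != i -> r j (m j) < r j v) -> r i v <= r i x.
  move=> Mv; have [j hj] := dx v; have [ji|/Mv] := eqVneq j i.
    by rewrite -ji hj // !inE eqxx.
  by have := hj (m j); rewrite !inE mg orbT => /(_ isT); lia.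
have : (i == a) || (i == b) by apply: (excl i k) => //; rewrite eq_sym.
case/orP=> /eqP e; rewrite e in Mx xmax.
  suff -> : x = xa by rewrite eqxx.
  by apply: (r_inj (i := a)); apply/eqP; rewrite eqn_leq xamax ?xmax.
suff -> : x = xb by rewrite eqxx orbT.
by apply: (r_inj (i := b)); apply/eqP; rewrite eqn_leq xbmax ?xmax.
Qed.

End Dominance.

Section Rainbow.
Import boot.fintype boot.finset.
Variables (U I : finType) (r : I -> U -> nat).
Hypothesis r_inj : forall i, injective (r i).
(* The special elements [s i] play the part of the vertices of a large simplex
   around the others: least for their own order, above all the ordinary elements
   for the other orders. *)
Variables (c : U -> I) (s : I -> U).
Hypothesis cs : forall i, c (s i) = i.
Hypothesis s_min : forall i v, r i (s i) <= r i v.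
Hypothesis s_max : forall i j t,
  i != j -> t \notin codom s -> r i t < r i (s j).

Local Notation dominant := (dominant r).

Let room (b : {set U}) := dominant b && (#|b| == #|I|).
Let door i0 (g : {set U}) := (c @: g == [set~ i0]) && (#|g|.+1 == #|I|).

Lemma rooms_of_door (g : {set U}) : #|g|.+1 = #|I| ->
  #|[set b | room b & g \subset b]|
    = #|[set x | (x \notin g) && dominant (x |: g)]|.
Proof.
move=> cg; rewrite -(card_in_imset (f := fun x => x |: g)); last first.
  move=> x y; rewrite !inE => /andP[xg _] /andP[yg _] /setP/(_ x).
  by rewrite !inE eqxx (negPf xg) !orbF => /esym /eqP.
apply/eq_card => b; rewrite inE; apply/idP/imsetP.
  case/andP=> /andP[db /eqP cb] gb.
  have /eqP/cards1P[x bx] : #|b :\: g| = 1.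
    by rewrite cardsD (setIidPr gb) cb -cg subSnn.
  have bE : b = x |: g.
    by rewrite -bx setUC setDE setUIr setUCr setIT (setUidPr gb).
  exists x => //; rewrite inE -bE db andbT.
  have : x \in b :\: g by rewrite bx inE.
  by rewrite inE => /andP[].
case=> x; rewrite inE => /andP[xg dx] ->.
by rewrite /room dx cardsU1 xg -cg add1n eqxx subsetUr.
Qed.

(** A set of full size that misses a colour has, if it carries all of them
but [i0], exactly one repeated colour, and removing either of the
two elements that carry it leaves a door. *)
Lemma doors_of_room i0 (b : {set U}) : #|b| = #|I| -> c @: b != [set: I] ->
  ~~ odd #|[set g | door i0 g & g \subset b]|.
Proof.
move=> cb nb.
rewrite (_ : #|_| = #|[set x in b | c @: (b :\ x) == [set~ i0]]|); last first.
  rewrite -[RHS](card_in_imset (f := fun x => b :\ x)); last first.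
    move=> x y; rewrite !inE => /andP[xb _] /andP[yb _] /setP/(_ x).
    by rewrite !inE eqxx xb !andbT => /esym /negbFE /eqP.
  apply/eq_card => g; rewrite inE; apply/idP/imsetP.
    case/andP=> /andP[dg /eqP cg] gb.
    have /eqP/cards1P[x bx] : #|b :\: g| = 1.
      by rewrite cardsD (setIidPr gb) cb -cg subSnn.
    have gE : g = b :\ x by rewrite -bx setDDr setDv set0U (setIidPr gb).
    exists x => //; rewrite inE -gE dg andbT.
    have : x \in b :\: g by rewrite bx inE.
  by rewrite inE => /andP[].
  case=> x; rewrite inE => /andP[xb dx] ->.
  by rewrite /door dx subD1set andbT -cb (cardsD1 x b) xb add1n eqxx.
have [->|[x]] := set_0Vmem [set x in b | c @: (b :\ x) == [set~ i0]].
  by rewrite cards0.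
rewrite inE => /andP[xb /eqP cx].
have inj z : z \in b -> c @: (b :\ z) = [set~ i0] -> {in b :\ z &, injective c}.
  by move=> zb cz; apply/imset_injP; rewrite cz cardsC1 -cb (cardsD1 z b) zb.
have cxi : c x \in c @: (b :\ x).
  rewrite cx !inE; apply: contra nb => /eqP xi0.
  apply/eqP/setP => i; rewrite inE.
  have [->|ii0] := eqVneq i i0; first by rewrite -xi0 imset_f.
  have : i \in c @: (b :\ x) by rewrite cx !inE.
  by apply/subsetP/imsetS/subD1set.
have /imsetP[y] := cxi; rewrite !inE => /andP[yx yb] cxy.
rewrite (_ : [set z in b | _] = [set x; y]); first by rewrite cards2 eq_sym yx.
apply/setP => z; rewrite !inE; apply/idP/idP; last first.
  case/orP=> /eqP->; first by rewrite xb cx eqxx.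
  rewrite yb -cx; apply/eqP/setP => i; apply/imsetP/imsetP => -[u].
    rewrite !inE => /andP[uy ub] ->; have [->|ux] := eqVneq u x.
      by exists y; rewrite ?inE ?yx.
    by exists u; rewrite ?inE ?ux.
  rewrite !inE => /andP[ux ub] ->; have [->|uy] := eqVneq u y.
    by exists x; rewrite ?inE ?xb 1?eq_sym ?yx.
  by exists u; rewrite ?inE ?uy.
case/andP=> zb /eqP /(inj _ zb) h; apply: contraT.
rewrite negb_or => /andP[zx zy]; have := h x y.
rewrite !inE eq_sym zx eq_sym zy xb yb => /(_ isT isT cxy) /eqP.
by rewrite eq_sym (negPf yx).
Qed.

(** The outer door: beside special elements only, the order [i0] alone decides,
and it selects its largest ordinary element.  This is the one door of odd
degree. *)
Lemma special_door i0 t : t \notin codom s ->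
  #|[set x | (x \notin s @: [set~ i0]) && dominant (x |: s @: [set~ i0])]| = 1.
Proof.
move=> ts.
have [x xs xmax] : exists2 x, x \notin codom s &
    forall v, v \notin codom s -> r i0 v <= r i0 x.
  exists [arg max_(v > t | v \notin codom s) r i0 v];
  by case: arg_maxnP => // v vs h // u /h.
have out v : v \notin codom s -> v \notin s @: [set~ i0].
  by apply: contra => /imsetP[i _ ->]; rewrite codom_f.
apply/eqP/cards1P; exists x; apply/setP => y; rewrite !inE.
apply/andP/eqP => [[ys /dominantP dy]|->]; last first.
  split; first exact: out.
  apply/dominantP => v.
  have [/codomP[i ->]|vs] := boolP (v \in codom s); first by exists i.
  exists i0 => z; rewrite !inE => /orP[/eqP->|/imsetP[j]]; first exact: xmax.
  rewrite !inE => ji ->; apply/ltnW/s_max => //; by rewrite eq_sym.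
have noti v i : i != i0 -> v \notin codom s ->
    ~ (forall x0, x0 \in y |: [set s x | x in [set~ i0]] -> r i v <= r i x0).
  move=> ii vs h; have := h (s i).
  rewrite !inE imset_f ?inE // orbT => /(_ isT).
  rewrite leq_eqVlt ltnNge s_min orbF => /eqP /r_inj vE.
  by rewrite vE codom_f in vs.
have ymax v : v \notin codom s -> r i0 v <= r i0 y.
  move=> vs; have [i hi] := dy v; have [ii|ii] := eqVneq i i0.
    by rewrite -ii hi // !inE eqxx.
  by case: (noti _ _ ii vs hi).
have [/codomP[i yE]|yns] := boolP (y \in codom s).
  have ii : i = i0.
    apply/eqP; apply: contraT => ii; move: ys; rewrite yE imset_f // !inE //.
  have := ymax _ ts; rewrite leq_eqVlt ltnNge yE ii s_min orbF
    => /eqP /r_inj vE.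
  by rewrite vE codom_f in ts.
by apply: (r_inj (i := i0)); apply/eqP; rewrite eqn_leq xmax // ymax.
Qed.

(** Sperner's argument: count modulo 2 the pairs of a room and a door contained
in it.  If no room carried all the colours, the count by rooms would be even,
while the count by doors is odd because of the outer door. *)
Theorem rainbow_dominant t : t \notin codom s ->
  exists2 b : {set U}, dominant b & (c @: b = [set: I]) /\ #|b| = #|I|.
Proof.
move=> ts; pose i0 := c t.
have sI : injective s := can_inj cs.
have csK (A : {set I}) : c @: (s @: A) = A.
  by rewrite -imset_comp (eq_imset (g := id)) ?imset_id // => i /=; exact: cs.
case: (boolP [exists b : {set U},
    [&& dominant b, c @: b == [set: I] & #|b| == #|I|]]).
  by case/existsP=> b /and3P[? /eqP ? /eqP ?]; exists b.
rewrite negb_exists => /forallP none; exfalso.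
have Ipos : 0 < #|I| by apply/card_gt0P; exists i0.
have incidence : \sum_(b | room b) #|[set g | door i0 g & g \subset b]|
    = \sum_(g | door i0 g) #|[set b | room b & g \subset b]|.
  under eq_bigr do rewrite -sum1dep_card big_mkcondr.
  rewrite exchange_big /=; apply: eq_bigr => g _.
  by rewrite -sum1dep_card [RHS]big_mkcondr.
have [odd0 oddS] : odd 0 = false /\ {morph odd : m n / m + n >-> m (+) n}.
  by split=> // m n; exact: oddD.
have := congr1 odd incidence; rewrite !(big_morph _ oddS odd0) big1; last first.
  move=> b /andP[db cb]; apply/negbTE/doors_of_room; first exact/eqP.
  by apply: contra (none b) => ->; rewrite db.
have d0 : door i0 (s @: [set~ i0]).
  by rewrite /door csK card_imset // cardsC1 prednK ?eqxx.
rewrite (bigD1 (s @: [set~ i0])) //=.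
have /andP[_ /eqP cd0] := d0.
rewrite rooms_of_door // (special_door _ ts) big1 //
  => g /andP[/andP[/eqP cg /eqP ng] gs].
rewrite rooms_of_door //.
have [dg|ndg] := boolP (dominant g); last first.
  rewrite (_ : [set x | _] = set0) ?cards0 //; apply/setP => x; rewrite !inE.
  apply/negbTE; rewrite negb_and orbC; apply/orP; left.
  by apply: contra ndg; apply/dominantS/subsetUr.
have [u ug us] : exists2 u, u \in g & u \notin codom s.
  apply/exists_inP; apply: contraT; rewrite negb_exists_in => /forall_inP h.
  have gE : g = s @: (c @: g).
    have sc x : x \in g -> s (c x) = x.
      by move=> /h; rewrite negbK => /codomP[i ->]; rewrite cs.
    rewrite -imset_comp -[LHS]imset_id; apply: eq_in_imset => x xg /=.
    by rewrite sc.
  by rewrite gE cg eqxx in gs.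
rewrite (card_extension r_inj ug) // => a b y ab yg ymin.
have [sag|sag] := boolP (s a \in g); last first.
  by exists (s a) => i ia; exists u => //; exact: s_max.
have ya : y = s a.
  by apply: (r_inj (i := a)); apply/eqP; rewrite eqn_leq s_min (ymin _ sag).1.
have := s_max (j := a) (i := b); rewrite eq_sym ab => /(_ u isT us).
by rewrite -ya ltnNge (ymin _ ug).2.
Qed.
End Rainbow.

(** Ties between weights are broken by the enumeration of [T], and one special
element per order is adjoined to [T]; in a dominant set that carries all the
colours, an order is represented either by its special element or by an element
of [T] of that colour. *)
Theorem dominant_colours (T I : finType) (w : I -> T -> nat) (c : T -> I)
    (t0 : T) :
  exists s : {set T}, forall v, exists2 i, i \in c @: s &
    forall x, x \in s -> w i v <= w i x.
Proof.
(* [rho] compares lexicographically by weight and rank. *)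
pose rho i t := w i t * #|T| + enum_rank t.
have rho_mono i t u : rho i t <= rho i u -> w i t <= w i u.
  have T0 : 0 < #|T| by apply/card_gt0P; exists t0.
  have rhoE z : rho i z %/ #|T| = w i z by rewrite divnMDl // divn_small ?addn0.
  by move=> /(leq_div2r #|T|); rewrite !rhoE.
have rho_inj i : injective (rho i).
  move=> t u e; have wtu : w i t = w i u.
    by apply/eqP; rewrite eqn_leq !rho_mono ?e.
  by move: e; rewrite /rho wtu => /addnI /val_inj /enum_rank_inj.
pose B i := \max_t (rho i t).+2.
(* The shift by one keeps the value 0 for the special element. *)
pose r i (u : T + I) := match u with
  | inl t => (rho i t).+1
  | inr j => if j == i then 0 else B i + enum_rank j end.
have rB i t : rho i t < (B i).-1.
  by have := leq_bigmax (F := fun t => (rho i t).+2) t; rewrite -/(B i); lia.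
have r_inj i : injective (r i).
  move=> [t|j] [u|k] /=.
  - by move=> [/rho_inj->].
  - by have := rB i t; case: ifP => // _; lia.
  - by have := rB i u; case: ifP => // _; lia.
  - have := rB i t0; case: ifP => [/eqP->|_]; case: ifP => [/eqP->|_] //;
    try lia.
    by move=> _ /addnI /val_inj /enum_rank_inj->.
pose col (u : T + I) := match u with inl t => c t | inr i => i end.
have [] := @rainbow_dominant _ _ r r_inj col inr _ _ _ (inl t0).
- by [].
- by move=> i v; rewrite /= eqxx.
- move=> i j [t|k] ij; last by rewrite codom_f.
  by move=> _ /=; rewrite eq_sym (negPf ij); have := rB i t; lia.
- by apply/codomP => -[].
move=> b /dominantP db [bI cb].
have cinj : {in b &, injective col} by apply/imset_injP; rewrite bI cardsT cb.
exists [set t | inl t \in b] => v.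
have [i hi] := db (inl v).
have ib : inr i \notin b by apply/negP => /hi; rewrite /= eqxx.
have /imsetP[[t|j] ub e] : i \in col @: b by rewrite bI inE.
  exists i; last by move=> x; rewrite inE => /hi; exact: rho_mono.
  rewrite [i]e /=; apply: imset_f; by rewrite inE.
by rewrite e ub in ib.
Qed.

(** * A covering theorem for the simplex *)

(** The points of a dominant set [s] for the coordinates are close together: if
[mu] is the vector of their least coordinates and [C] the set of their colours,
the sum of [mu] over [C] exceeds [m - #|C|], for otherwise a grid point with
coordinates [mu i + 1] on [C] would not be dominated.  So all the points of [s]
are within [#|C|] of [mu] restricted to [C], completed to a grid point [p] of
the face [C]. *)
Theorem grid_cover (I : finType) (m : nat) (c : {ffun I -> nat} -> I) :
  exists2 p : {ffun I -> nat}, \sum_i p i = m &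
    forall i, 0 < p i -> exists x : {ffun I -> nat},
      [/\ \sum_i x i = m, c x = i &
      forall j, p j <= x j + #|I| /\ x j <= p j + #|I| ].
Proof.
pose T := {x : {ffun I -> 'I_m.+1} | \sum_i x i == m}.
pose emb (x : T) : {ffun I -> nat} := [ffun i => val x i : nat].
have emb_sum x : \sum_i emb x i = m.
  by rewrite -[RHS](eqP (valP x)); apply: eq_bigr => i _; rewrite ffunE.
have embP (f : {ffun I -> nat}) : \sum_i f i = m -> exists x, emb x = f.
  move=> fm; have fi i : (inord (f i) : 'I_m.+1) = f i :> nat.
    by rewrite inordK // ltnS -fm (bigD1 i) //= leq_addr.
  pose g : {ffun I -> 'I_m.+1} := [ffun i => inord (f i)].
  have hx : \sum_i g i == m.
    by apply/eqP; rewrite -[RHS]fm; apply: eq_bigr => i _; rewrite ffunE fi.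
  by exists (exist _ g hx); apply/ffunP => i; rewrite !ffunE fi.
have sum_at (i1 : I) k : \sum_i (i == i1) * k = k.
  by rewrite (bigD1 i1) //= eqxx mul1n big1 ?addn0 // => i /negPf->.
have sum_in (A : {set I}) (f : I -> nat) :
    \sum_i (i \in A) * f i = \sum_(i in A) f i.
  by rewrite [RHS]big_mkcond; apply: eq_bigr => i _; case: ifP; rewrite ?mul1n.
have [t0 _] : exists t, emb t = [ffun i => (i == c [ffun=> 0]) * m].
  by apply: embP; under eq_bigr do rewrite ffunE; exact: sum_at.
have [s hs] := dominant_colours (fun i t => emb t i) (c \o emb) t0.
set C := (c \o emb) @: s in hs.
have [i1 i1C _] := hs t0.
have /imsetP[x0 x0s _] := i1C.
pose mu i := emb [arg min_(x < x0 in s) emb x i] i.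
have mu_le i x : x \in s -> mu i <= emb x i.
  by rewrite /mu; case: arg_minnP => // y _ h /h.
have mu_ge i k : (forall x, x \in s -> k <= emb x i) -> k <= mu i.
  by rewrite /mu; case: arg_minnP => // y ys _; exact.
pose q i := (i \in C) * mu i.
pose S := \sum_i q i.
have q_le i x : x \in s -> q i <= emb x i.
  by move=> xs; rewrite /q; case: (i \in C); rewrite ?mul1n ?mu_le.
have S_le : S <= m by rewrite -(emb_sum x0); apply: leq_sum => i _; exact: q_le.
have S_gt : m < S + #|C|.
  rewrite ltnNge; apply/negP => Sm.
  pose f := [ffun i => (i \in C) * (mu i).+1 + (i == i1) * (m - (S + #|C|))].
  have [v vf] : exists v, emb v = f.
    apply: embP; under eq_bigr do rewrite ffunE.
    rewrite big_split /= sum_at sum_in; under eq_bigr do rewrite -addn1.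
    by rewrite big_split /= sum1_card -sum_in -/S subnKC.
  have [i iC hi] := hs v.
  have := mu_ge _ _ hi; rewrite vf ffunE iC; lia.
have x_le x i : x \in s -> emb x i <= q i + (m - S).
  move=> xs; have : \sum_i (emb x i - q i) = m - S.
    by rewrite sumnB ?emb_sum // => j _; exact: q_le.
  by rewrite (bigD1 i) //=; have := q_le i x xs; lia.
have CI : #|C| <= #|I| by exact: max_card.
exists [ffun i => q i + (i == i1) * (m - S)].
  by under eq_bigr do rewrite ffunE; rewrite big_split /= sum_at subnKC.
move=> i; rewrite ffunE => pi.
have /imsetP[x xs ->] : i \in C.
  apply: contraLR pi => iC; rewrite /q (negPf iC).
  by have /negPf-> : i != i1 by apply: contraNneq iC => ->.
exists (emb x); split=> // j; rewrite ffunE.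
have := x_le x j xs; have := q_le j x xs.
by case: (j == i1); lia.
Qed.

Import Order.TTheory GRing.Theory Num.Theory.
Import numFieldNormedType.Exports.

Local Open Scope classical_set_scope.
Local Open Scope ring_scope.

Section Convexity.
Context (R : realType) (E : lmodType R).

Lemma convex_setP (A : set E) : convex_set A <->
  forall x y (t : R), A x -> A y -> 0 <= t <= 1 -> A (t *: x + (1 - t) *: y).
Proof.
split=> [cA x y t Ax Ay /andP[t0 t1]|cA x y t].
  have := cA x y (Itv01 t0 t1); rewrite !inE; exact.
rewrite !inE => Ax Ay; apply: (cA _ _ t%:num) => //.
by rewrite ge0 le1.
Qed.

(** Jensen's inclusion.  The weights are normalised along the induction, so the
invariant concerns partial sums with positive total weight; points with zero
weight need not be in [A]. *)
Lemma convex_combination (A : set E) n (l : 'I_n -> R) (y : 'I_n -> E) :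
    convex_set A -> (forall i, 0 <= l i) -> \sum_i l i = 1 ->
    (forall i, 0 < l i -> A (y i)) ->
  A (\sum_i l i *: y i).
Proof.
move=> /convex_setP cA l0 l1 Ay.
have cone (s : seq 'I_n) : \sum_(i <- s) l i = 0 /\ \sum_(i <- s) l i *: y i = 0
    \/ 0 < \sum_(i <- s) l i /\
       A ((\sum_(i <- s) l i)^-1 *: \sum_(i <- s) l i *: y i).
  elim: s => [|i s IH]; first by left; rewrite !big_nil.
  rewrite !big_cons.
  move: IH; set L := \sum_(i <- s) l i; set Y := \sum_(i <- s) l i *: y i => IH.
  have := l0 i; rewrite le_eqVlt => /predU1P[<-|li];
    first by rewrite scale0r !add0r.
  case: IH => [[-> ->]|[L0 AL]]; right.
    by rewrite !addr0 scalerA mulVf ?gt_eqF // scale1r; split=> //; exact: Ay.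
  have LL : 0 < l i + L by exact: addr_gt0.
  split=> //.
  have := cA _ _ (l i / (l i + L)) (Ay _ li) AL.
  rewrite (_ : _ *: y i + _ = (l i + L)^-1 *: (l i *: y i + Y)); first apply.
    by rewrite divr_ge0 ?(ltW li) ?(ltW LL) //= ler_pdivrMr // mul1r lerDl ltW.
  rewrite scalerDr !scalerA mulrC; congr (_ + _ *: _).
  by field; rewrite !gt_eqF.
case: (cone (index_enum 'I_n)) => [[]|[_]].
  by rewrite l1 => /eqP; rewrite oner_eq0.
by rewrite l1 invr1 scale1r.
Qed.

End Convexity.

Lemma cvg_sumv (R : realType) (V : normedModType R) (T I : Type)
    (F : set_system T) {FF : Filter F} (r : seq I)
    (f : I -> T -> V) (l : I -> V) :
    (forall i, f i x @[x --> F] --> l i) ->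
  \sum_(i <- r) f i x @[x --> F] --> \sum_(i <- r) l i.
Proof. by move=> h; apply: cvg_big => //; exact: add_continuous. Qed.

Definition unit_simplex (R : realType) n : set 'rV[R]_n :=
  [set l | (forall i, 0 <= l 0 i) /\ \sum_i l 0 i = 1].

Lemma compact_unit_simplex (R : realType) n : compact (@unit_simplex R n).
Proof.
have Kc : compact [set v : 'rV[R]_n | forall i, v ord0 i \in `[0, 1]].
  by apply: (@rV_compact _ _ (fun=> `[(0 : R), 1]%classic)) => _;
    exact: segment_compact.
apply: subclosed_compact Kc _; last first.
  move=> l [l0 l1] i /=; rewrite in_itv /= l0 -l1 (bigD1 i) //= lerDl.
  by apply: sumr_ge0 => j _.
rewrite (_ : @unit_simplex R n =
    (\bigcap_(i in [set: 'I_n]) [set l : 'rV[R]_n | 0 <= l 0 i]) `&`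
    [set l : 'rV[R]_n | \sum_i l 0 i = 1]); last first.
  by apply/seteqP; split=> l [h1 h2]; split => // i; [move=> _|]; exact: h1.
apply: closedI.
  apply: closed_bigI => i _.
  apply: (@preimage_closed _ _ (fun l : 'rV[R]_n => l 0 i) [set x | 0 <= x]).
    by move=> l _; exact: coord_continuous.
  exact: closed_ge.
apply: (@preimage_closed _ _ (fun l : 'rV[R]_n => \sum_i l 0 i)
  [set x | x = 1]).
  move=> l _; apply: (@cvg_sumv R R^o _ _ (nbhs l) _ _
    (fun i (l : 'rV[R]_n) => l 0 i)).
  by move=> i; exact: coord_continuous.
exact: closed_eq.
Qed.

(** A dual form of the Knaster - Kuratowski - Mazurkiewicz theorem, without
boundary condition.  By a Lebesgue number argument each point [l] has an index
[i] such that [U i] contains all the points within [n.+1 / m.+1] of [l], for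
some large [m]; colouring the grid points by such an index, [grid_cover] yields
a point close to a point of every colour of its face. *)
Theorem simplex_cover (R : realType) n (U : 'I_n.+1 -> set 'rV[R]_n.+1) :
    (forall l, unit_simplex l -> exists i, nbhs l (U i)) ->
  exists2 l, unit_simplex l & forall i, 0 < l 0 i -> U i l.
Proof.
move=> cov.
pose P (m : nat) (l : 'rV[R]_n.+1) := exists i, forall l' : 'rV[R]_n.+1,
  (forall j, `|l 0 j - l' 0 j| <= n.+1%:R / m.+1%:R) -> U i l'.
have /compact_near_coveringP/(_ nat \oo P _) := @compact_unit_simplex R n.+1.
case.
  move=> l /cov[i /nbhs_ballP[e /= e0 lU]].
  have e4 : 0 < e / 2 / n.+1%:R by rewrite !divr_gt0.
  near=> l' m; exists i => l'' h; apply: lU; rewrite -ball_normE /=.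
  have -> : l - l'' = (l - l') + (l' - l'') by rewrite addrA subrK.
  apply: le_lt_trans (ler_normD _ _) _; rewrite (splitr e); apply: ltr_leD.
    by near: l'; apply: cvgr_dist_lt; rewrite ?divr_gt0.
  rewrite /Num.norm /= mx_normrE; apply/bigmax_leP; split=> [|[i1 j] _ /=].
    by rewrite ltW // divr_gt0.
  rewrite ord1 !mxE; apply: le_trans (h j) _.
  have : m.+1%:R^-1 < e / 2 / n.+1%:R.
    by near: m; exact: (near_infty_natSinv_lt (PosNum e4)).
  by rewrite ltr_pdivlMr // mulrC => /ltW.
move=> m _ /(_ m (leqnn m)) Pm.
pose toR (x : {ffun 'I_n.+1 -> nat}) : 'rV[R]_n.+1 :=
  \row_i ((x i)%:R / m.+1%:R).
have toR_simplex (x : {ffun 'I_n.+1 -> nat}) :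
    (\sum_i x i = m.+1)%N -> unit_simplex (toR x).
  move=> xm; split=> [i|]; first by rewrite mxE divr_ge0.
  under eq_bigr do rewrite mxE.
  by rewrite -mulr_suml -natr_sum xm divff // pnatr_eq0.
have /choice[c hc] : forall x : {ffun 'I_n.+1 -> nat}, exists i : 'I_n.+1,
    (\sum_i x i = m.+1)%N -> forall l' : 'rV[R]_n.+1,
    (forall j, `|toR x 0 j - l' 0 j| <= n.+1%:R / m.+1%:R) -> U i l'.
  move=> x.
  have [xm|xm] := pselect (\sum_i x i = m.+1)%N; last by exists ord0.
  by have [i hi] := Pm _ (toR_simplex _ xm); exists i.
have [p pm hp] := @grid_cover 'I_n.+1 m.+1 c.
exists (toR p); first exact: toR_simplex.
move=> i; rewrite mxE pmulr_lgt0 ?invr_gt0 // ltr0n => /hp[x [xm <- xp]].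
apply: hc => // j; rewrite !mxE -mulrBl normrM normfV normr_nat.
rewrite ler_pM2r ?invr_gt0 //; have [h1 h2] := xp j.
have {}h1 : (p j)%:R <= (x j)%:R + n.+1%:R :> R.
  by rewrite -natrD ler_nat; apply: leq_trans h1 _; rewrite card_ord.
have {}h2 : (x j)%:R <= (p j)%:R + n.+1%:R :> R.
  by rewrite -natrD ler_nat; apply: leq_trans h2 _; rewrite card_ord.
by rewrite ler_norml; lra.
Unshelve. all: by end_near.
Qed.

(** * The Ky Fan - Browder theorem on products of finite-dimensional spaces *)

(** Finite subcovers are extracted in pointed spaces. *)
HB.instance Definition _ (R : realType) (N : finType) (d : N -> nat) :=
  isPointed.Build (profile R d) 0.

Section Profile.
Context (R : realType) (N : finType) (d : N -> nat).
Local Notation E := (profile R d).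

Lemma profile_cvg (T : Type) (F : set_system T) {FF : Filter F}
    (f : T -> E) (l : E) :
    (forall nu, f x nu @[x --> F] --> l nu) -> f x @[x --> F] --> l.
Proof.
move=> h; apply/cvg_sup => nu A [_ [[B Bop <-] Bl sBA]].
apply: filterS sBA _; apply: (h nu); exact: open_nbhs_nbhs.
Qed.

Lemma profile_proj_continuous nu : continuous (fun x : E => x nu).
Proof. exact: (@proj_continuous _ (fun nu : N => 'rV[R]_(d nu)) nu). Qed.

Lemma profile_sumE (I : finType) (f : I -> E) nu :
  (\sum_i f i) nu = \sum_i f i nu.
Proof.
elim/big_ind2: _ => // x1 x2 y1 y2 <- <-; reflexivity.
Qed.

(** If every point of [K] were related to some point of [K], finitely many
[y i] would serve for all of [K].  In the simplex of their convex combinations,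
[simplex_cover] gives a combination [x] related to each [y i] of positive
weight, hence to [x] itself by convexity. *)
Theorem maximal_element (K : set E) (B : E -> set E) :
    compact K -> K !=set0 -> convex_set K ->
    (forall y, open [set x | B x y]) -> (forall x, convex_set (B x)) ->
    (forall x, ~ B x x) ->
  exists2 x, K x & forall y, K y -> ~ B x y.
Proof.
move=> Kco [x0 Kx0] Kcv Bop Bcv Birr.
apply: contrapT => none.
have cov : K `<=` cover K (fun y => [set x | B x y]).
  move=> x Kx; apply: contrapT => nx; apply: none; exists x => // y Ky Bxy.
  by apply: nx; exists y.
have : cover_compact K by rewrite -compact_cover.
move=> /(_ _ _ _ (fun y _ => Bop y) cov)[D DK Dcov].
pose s : seq E := finmap.enum_fset D.
have [n sn] : exists n, size s = n.+1.
  have [y yD _] := Dcov _ Kx0; have : y \in s by exact: yD.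
  by case: s => // a s' _; exists (size s').
pose y (i : 'I_n.+1) : E := nth 0 s i.
have yK i : K (y i).
  have : y i \in s by rewrite mem_nth // sn.
  by move=> /DK; rewrite inE.
pose f (l : 'rV[R]_n.+1) : E := \sum_i l 0 i *: y i.
have fcont : continuous f.
  move=> l; apply: (profile_cvg (F := nbhs l)) => nu; rewrite /f.
  under eq_fun do rewrite profile_sumE.
  rewrite profile_sumE; apply: (cvg_sumv (F := nbhs l)
    (f := fun i (l : 'rV[R]_n.+1) => (l 0 i *: y i) nu)) => i.
  by apply: (@cvgZr_tmp _ _ _ (nbhs l)); exact: coord_continuous.
have fK l : unit_simplex l -> K (f l).
  by case=> l0 l1; apply: convex_combination.
have [l lS hl] : exists2 l, unit_simplex l & 
    forall i, 0 < l 0 i -> B (f l) (y i).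
  apply: (@simplex_cover R n (fun i l => B (f l) (y i))) => l lS.
  have [z zD Bz] := Dcov _ (fK l lS).
  have zs : (index z s < n.+1)%N by rewrite -sn index_mem.
  exists (Ordinal zs).
  have -> : y (Ordinal zs) = z by rewrite /y nth_index // -index_mem sn.
  exact: (fcont l _ (open_nbhs_nbhs (conj (Bop z) Bz))).
by apply: (Birr (f l)); case: lS => l0 l1; apply: convex_combination.
Qed.

End Profile.

(** * Compactness of the balls of an arbitrary norm *)

Section Norm.
Context (R : realType) (N : finType) (d : N -> nat).
Local Notation E := (profile R d).
Context (nrm : E -> R) (hnrm : is_norm nrm).

Let nrm0 : nrm 0 = 0.
Proof. by have := is_normZ hnrm 0 0; rewrite scale0r normr0 mul0r. Qed.

Let nrmN x : nrm (- x) = nrm x.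
Proof.
by have := is_normZ hnrm (-1) x; rewrite scaleN1r normrN normr1 mul1r.
Qed.

Lemma is_norm_ge0 x : 0 <= nrm x.
Proof.
have := is_norm_triangle hnrm x (- x).
by rewrite subrr nrm0 nrmN -mulr2n pmulrn_lge0.
Qed.

Let nrm_sum (I : finType) (f : I -> E) : nrm (\sum_i f i) <= \sum_i nrm (f i).
Proof.
elim/big_ind2: _ => [|x a y b xa yb|//]; first by rewrite nrm0.
exact: le_trans (is_norm_triangle hnrm _ _) (lerD xa yb).
Qed.

Let basis_vec nu (j : 'I_(d nu)) : E :=
  deviate 0 (delta_mx 0 j : 'rV[R]_(d nu)).

Let profile_basis (x : E) : x = \sum_nu \sum_j x nu 0 j *: basis_vec j.
Proof.
apply: functional_extensionality_dep => mu.
rewrite profile_sumE (bigD1 mu) //= profile_sumE.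
rewrite [X in _ = _ + X]big1 ?addr0; last first.
  move=> nu numu; rewrite profile_sumE big1 // => j _.
  by rewrite [LHS](_ : _ = x nu 0 j *: basis_vec j mu) // /basis_vec /deviate
    dfwithout // scaler0.
rewrite [LHS]row_sum_delta; apply: eq_bigr => j _.
by rewrite [RHS](_ : _ = x mu 0 j *: basis_vec j mu) // /basis_vec /deviate
  dfwithin.
Qed.

Let coord_bound (x : E) : R := \sum_nu \sum_j `|x nu 0 j| * nrm (basis_vec j).

Let nrm_le_coord x : nrm x <= coord_bound x.
Proof.
rewrite [x in nrm x]profile_basis; apply: le_trans (nrm_sum _) _.
apply: ler_sum => nu _; apply: le_trans (nrm_sum _) _.
by apply: ler_sum => j _; rewrite (is_normZ hnrm).
Qed.

Lemma norm_continuous_profile : continuous nrm.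
Proof.
move=> x; apply/(cvgrPdist_lt (F := nbhs x)) => eps eps0.
have gcvg : coord_bound (x - y) @[y --> x] --> (0 : R).
  rewrite -[X in _ --> X](_ : coord_bound (x - x) = 0); last first.
    rewrite subrr /coord_bound big1 // => nu _; rewrite big1 // => j _.
    by rewrite [X in `|X|](_ : _ = 0) ?normr0 ?mul0r // mxE.
  apply: (@cvg_sumv R R^o _ _ (nbhs x) _ _
    (fun nu y => \sum_j `|(x - y) nu 0 j| * nrm (basis_vec j))) => nu.
  apply: (@cvg_sumv R R^o _ _ (nbhs x) _ _
    (fun j y => `|(x - y) nu 0 j| * nrm (basis_vec j))) => j.
  apply: cvgMr_tmp; apply: cvg_norm.
  have -> : (fun y : E => (x - y) nu 0 j) = (fun y => x nu 0 j - y nu 0 j).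
    by apply/funext => y; rewrite [LHS](_ : _ = (x nu - y nu) 0 j) // !mxE.
  rewrite (_ : (x - x) nu 0 j = x nu 0 j - x nu 0 j); last first.
    by rewrite [LHS](_ : _ = (x nu - x nu) 0 j) // !mxE.
  apply: cvgB; first exact: cvg_cst.
  apply: (cvg_comp (fun y : E => y nu) (fun v : 'rV[R]_(d nu) => v 0 j)).
    exact: profile_proj_continuous.
  exact: coord_continuous.
near=> y.
have gy : coord_bound (x - y) < eps.
  by near: y; exact: (cvgr_lt (0 : R) gcvg eps eps0).
apply: le_lt_trans gy; apply: le_trans (nrm_le_coord _).
rewrite ler_norml lerBlDr lerNl opprB lerBlDr; apply/andP; split.
  have := is_norm_triangle hnrm (y - x) x.
  by rewrite subrK -[nrm (y - x)]nrmN opprB.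
by have := is_norm_triangle hnrm (x - y) y; rewrite subrK.
Unshelve. all: by end_near.
Qed.

Let coord_sum (x : E) : R := \sum_nu `|x nu|.

Let coord_sum_continuous : continuous coord_sum.
Proof.
move=> x; apply: (@cvg_sumv R R^o _ _ (nbhs x) _ _ (fun nu (y : E) => `|y nu|))
  => nu.
apply: cvg_norm; exact: profile_proj_continuous.
Qed.

Let compact_box (M : R) : compact [set x : E | forall nu, `|x nu| <= M].
Proof.
apply: (@tychonoff _ (fun nu => 'rV[R]_(d nu)) (fun nu => [set v | `|v| <= M]))
  => nu.
apply: bounded_closed_compact.
  exists M; split; first exact: num_real.
  by move=> b Mb v /= vM; apply: le_trans vM (ltW Mb).
apply: (@preimage_closed _ _ (fun v : 'rV[R]_(d nu) => `|v|) [set x | x <= M]).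
  by move=> v _; exact: norm_continuous.
exact: closed_le.
Qed.

Let le_coord_sum x nu : `|x nu| <= coord_sum x.
Proof. by rewrite /coord_sum (bigD1 nu) //= lerDl sumr_ge0. Qed.

(* The minimum of the norm on the unit sphere for the sum of the coordinate
   norms, if that sphere is not empty (all the dimensions may be 0). *)
Let norm_bound : exists2 c, 0 < c & forall x, c * coord_sum x <= nrm x.
Proof.
pose S : set E := [set x | coord_sum x = 1].
have Sc : compact S.
  apply: subclosed_compact (@compact_box 1) _; last first.
    by move=> x Sx nu; rewrite -Sx; exact: le_coord_sum.
  apply: (@preimage_closed _ _ coord_sum [set x | x = 1]);
    last exact: closed_eq.
  by move=> x _; exact: coord_sum_continuous.
have [c c0 hc] : exists2 c, 0 < c & forall x, S x -> c <= nrm x.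
  have [S0|S0] := pselect (S !=set0); last first.
    by exists 1 => // x Sx; case: S0; exists x.
  have [x xS xmin] := compact_EVT_min S0 Sc (continuous_subspaceT
    norm_continuous_profile).
  rewrite inE in xS.
  exists (nrm x); last by move=> y Sy; apply: xmin; rewrite inE.
  rewrite lt_def is_norm_ge0 andbT; apply/eqP => /(is_norm_eq0 hnrm) x0.
  move: xS; rewrite /S /= /coord_sum big1 => [/esym/eqP|nu _];
    first by rewrite oner_eq0.
  by rewrite x0 normr0.
exists c => // x.
have [->|s0] := eqVneq (coord_sum x) 0; first by rewrite mulr0 is_norm_ge0.
have sp : 0 < coord_sum x by rewrite lt_def s0 sumr_ge0.
have /hc : S ((coord_sum x)^-1 *: x).
  rewrite /S /= {1}/coord_sum -[RHS](mulVf s0) mulr_sumr;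
    apply: eq_bigr => nu _.
  by rewrite [X in `|X|](_ : _ = (coord_sum x)^-1 *: x nu) // normrZ gtr0_norm
    ?invr_gt0.
rewrite (is_normZ hnrm) gtr0_norm ?invr_gt0 // mulrC ler_pdivlMr //.
Qed.

Lemma compact_cball (rho : R) : compact (cball nrm rho).
Proof.
have [c c0 hc] := norm_bound.
apply: subclosed_compact (@compact_box (rho / c)) _; last first.
  move=> x; rewrite /cball /= => xr nu; apply: le_trans (le_coord_sum x nu) _.
  by rewrite ler_pdivlMr // mulrC (le_trans (hc x)).
apply: (@preimage_closed _ _ nrm [set x | x <= rho]); last exact: closed_le.
by move=> x _; exact: norm_continuous_profile.
Qed.

Lemma convex_cball (rho : R) : convex_set (cball nrm rho).
Proof.
apply/convex_setP => x y t; rewrite /cball /= => xr yr /andP[t0 t1].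
apply: le_trans (is_norm_triangle hnrm _ _) _.
rewrite !(is_normZ hnrm) !ger0_norm ?subr_ge0 //.
have := ler_wpM2l t0 xr.
have : (1 - t) * nrm y <= (1 - t) * rho by rewrite ler_wpM2l // subr_ge0.
lra.
Qed.

End Norm.

(** * The game on a compact convex set *)

(** Pseudo-continuity makes strict inequality open in both points jointly.  If
a value [f c] lies strictly between, it separates the two neighbourhoods.  If
none does, [f a' < f b] already forces [f a' <= f a], and [f a < f b'] forces
[f b <= f b']. *)
Lemma pseudo_continuous_lt (R : realType) (T : topologicalType) (f : T -> R)
    (a b : T) :
    pseudo_continuous f -> f a < f b ->
  \forall a' \near a & b' \near b, f a' < f b'.
Proof.
move=> [uf lf] ab.
have [[c [ac cb]]|nc] := pselect (exists c, f a < f c /\ f c < f b).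
  have fbc : - f b < - f c by rewrite ltrN2.
  near=> a' b'.
  have a'c : f a' < f c by near: a'; exact: uf.
  have cb' : - f b' < - f c by near: b'; exact: lf.
  by apply: lt_trans a'c _; rewrite -ltrN2.
have nab : - f b < - f a by rewrite ltrN2.
near=> a' b'.
have a'b : f a' < f b by near: a'; exact: uf.
have ab' : - f b' < - f a by near: b'; exact: lf.
rewrite ltrN2 in ab'.
have a'a : f a' <= f a by rewrite leNgt; apply/negP => h; apply: nc; exists a'.
have bb' : f b <= f b' by rewrite leNgt; apply/negP => h; apply: nc; exists b'.
exact: le_lt_trans a'a (lt_le_trans ab bb').
Unshelve. all: by end_near.
Qed.

Section Deviate.
Context (R : realType) (N : finType) (d : N -> nat).
Local Notation E := (profile R d).

Lemma deviate_id (x : E) nu : deviate x (x nu) = x.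
Proof.
by apply: functional_extensionality_dep => mu; rewrite /deviate; case: dfwithP.
Qed.

Lemma deviate_conv (x : E) nu (v w : 'rV[R]_(d nu)) (t : R) :
  deviate x (t *: v + (1 - t) *: w)
    = t *: deviate x v + (1 - t) *: deviate x w :> E.
Proof.
apply: functional_extensionality_dep => mu.
change (deviate x (t *: v + (1 - t) *: w) mu
  = t *: deviate x v mu + (1 - t) *: deviate x w mu).
have [e|ne] := eqVneq nu mu; first by subst mu; rewrite /deviate !dfwithin.
by rewrite /deviate !dfwithout // -scalerDl addrC subrK scale1r.
Qed.

Lemma deviate_continuous nu :
  continuous (fun p : E * 'rV[R]_(d nu) => deviate p.1 p.2).
Proof.
move=> [x v]; apply: (profile_cvg (F := nbhs (x, v))) => mu.
have [e|ne] := eqVneq nu mu.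
  subst mu; rewrite /deviate dfwithin /=.
  under eq_fun do rewrite dfwithin.
  exact: cvg_snd.
rewrite /deviate /= dfwithout //.
under eq_fun do rewrite dfwithout //.
apply: (cvg_comp (fst : E * 'rV[R]_(d nu) -> E) (fun x : E => x mu)).
  exact: cvg_fst.
exact: profile_proj_continuous.
Qed.

End Deviate.

Section Equilibrium.
Context (R : realType) (N : finType) (d : N -> nat).
Local Notation E := (profile R d).
Context (theta : N -> E -> R).
Hypothesis theta_pc : forall nu, pseudo_continuous (theta nu).
Hypothesis theta_qc : forall nu (x : E),
  quasi_convex (fun v : 'rV[R]_(d nu) => theta nu (deviate x v)).

(** The whole ball around [s] is better than the current strategy, at all
profiles near [x].  Building stability under perturbation of [x] into the
definition makes [improves] open in [x] without any compactness. *)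
Definition robustly_better (x : E) nu (s : 'rV[R]_(d nu)) (r : R) : Prop :=
  0 < r /\ \forall x' \near x, forall v : 'rV[R]_(d nu), `|v - s| < r ->
    theta nu (deviate x' v) < theta nu x'.

Lemma exists_robustly_better (x : E) nu (s : 'rV[R]_(d nu)) :
  theta nu (deviate x s) < theta nu x -> exists r, robustly_better x s r.
Proof.
move=> /(pseudo_continuous_lt (theta_pc nu))[[U V] /= [Us Vx] UV].
have [[P Q] /= [Px Qs] PQ] := @deviate_continuous R N d nu (x, s) U Us.
have /nbhs_ballP[r /= r0 sr] := Qs.
exists r; split=> //; apply: filterS (filterI Px Vx) => x' [Px' Vx'] v vs.
apply: (UV (deviate x' v, x')); split => //=; apply: (PQ (x', v)); split => //=.
by apply: sr; rewrite -ball_normE /= distrC.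
Qed.

Lemma robustly_better_near (x : E) nu (s : 'rV[R]_(d nu)) r :
  robustly_better x s r -> \forall x' \near x, robustly_better x' s r.
Proof. by move=> [r0 /nbhs_interior]; apply: filterS. Qed.

(** A vector shorter than [a * r + (1 - a) * r'] splits into parts shorter than
[r] and [r'], with weights [a] and [1 - a], in proportion to the radii. *)
Lemma robustly_better_conv (x : E) nu (s s' : 'rV[R]_(d nu)) r r' (a : R) :
    robustly_better x s r -> robustly_better x s' r' -> 0 <= a <= 1 ->
  robustly_better x (a *: s + (1 - a) *: s') (a * r + (1 - a) * r').
Proof.
move=> [r0 xs] [r'0 xs'] a01; have /andP[a0 a1] := a01.
set rho := a * r + _.
have rho0 : 0 < rho.
  move: a0; rewrite /rho le_eqVlt => /predU1P[<-|ap].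
    by rewrite mul0r subr0 mul1r add0r.
  by rewrite ltr_pwDl ?mulr_gt0 // mulr_ge0 ?subr_ge0 // ltW.
split=> //; apply: filterS (filterI xs xs') => x' [hs hs'] v vlt.
have [w wE] : exists w, w = v - (a *: s + (1 - a) *: s') by eexists.
have wlt : `|w| / rho < 1 by rewrite wE ltr_pdivrMr ?mul1r.
have close q : 0 < q -> `|(q / rho) *: w| < q.
  move=> q0; rewrite normrZ gtr0_norm ?divr_gt0 //.
  by rewrite mulrAC -mulrA gtr_pMr.
have vE : v = a *: (s + (r / rho) *: w) + (1 - a) *: (s' + (r' / rho) *: w).
  rewrite !scalerDr addrACA -[LHS](subrK (a *: s + (1 - a) *: s')) addrC.
  rewrite -wE !scalerA; congr (_ + _); rewrite -scalerDl -[LHS]scale1r;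
    congr (_ *: _).
  by rewrite -[LHS](divff (lt0r_neq0 rho0)) /rho; ring.
rewrite vE; apply: le_lt_trans (theta_qc x' _ _ a01) _.
rewrite gt_max; apply/andP; split; [apply: hs|apply: hs'];
  by rewrite addrC addKr close.
Qed.

(** For a player and a displacement [u], the infimum of
[`|u - t *: (s - x nu)| - t * r] over [t >= 0] and the robustly better balls of
centre [s] and radius [r] is a signed distance from [u] to the cone of improving
directions: it is sublinear in [u], upper semicontinuous in [x], zero at
[u = 0], and negative if [x nu + u] is strictly better.  [improves x y] says
that the sum over the players of these functions at [y - x] is negative.  The
value [t = 0], whose term is [`|u|], is always allowed; it is the only one for a
player who has nothing better. *)
Definition improves (x y : E) : Prop :=
  exists (t : N -> R) (s : E) (r : N -> R),
  (forall nu, 0 <= t nu /\ (0 < t nu -> robustly_better x (s nu) (r nu))) /\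
  \sum_nu `|y nu - x nu - t nu *: (s nu - x nu)| < \sum_nu t nu * r nu.

Lemma improves_open y : open [set x | improves x y].
Proof.
rewrite openE => x [t [s [r [tsr lt]]]]; rewrite /interior.
have near_better : \forall x' \near x, forall nu, 0 < t nu ->
    robustly_better x' (s nu) (r nu).
  apply: (@filter_forall _ _
    (fun nu x' => 0 < t nu -> robustly_better x' (s nu) (r nu)) (nbhs x)) => nu.
  have [t0 h] := tsr nu.
  have [/h|tn] := boolP (0 < t nu).
    by move=> /robustly_better_near; apply: filterS.
  by apply: (filterE (F := nbhs x)).
have cvg_sum : \sum_nu `|y nu - x' nu - t nu *: (s nu - x' nu)| @[x' --> x]
    --> (\sum_nu `|y nu - x nu - t nu *: (s nu - x nu)| : R).
  apply: (@cvg_sumv R R^o _ _ (nbhs x) _ _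
    (fun nu (x' : E) => `|y nu - x' nu - t nu *: (s nu - x' nu)|)) => nu.
  apply: cvg_norm; apply: cvgB; first apply: cvgB.
  - exact: cvg_cst.
  - exact: profile_proj_continuous.
  - apply: cvgZl_tmp; apply: cvgB; first exact: cvg_cst.
    exact: profile_proj_continuous.
near=> x'; exists t, s, r; split.
  move=> nu; split; first by have [] := tsr nu.
  by move: (nu); near: x'.
by near: x'; exact: (cvgr_lt _ cvg_sum).
Unshelve. all: by end_near.
Qed.

(** The infimum above ranges over a convex cone of pairs
[(t *: (s - x nu), t * r)], so two witnesses can be added.  The weights [t] are
combined into [T], and the balls with the relative weight [a]; a ball whose
weight vanishes carries no information and must be left out. *)
Lemma improves_convex x : convex_set (improves x).
Proof.
apply/convex_setP => y y' l [t [s [r [tsr lt]]]] [t' [s' [r' [tsr' lt']]]].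
move=> /andP[l0 l1].
pose T nu := l * t nu + (1 - l) * t' nu.
pose a nu := l * t nu / T nu.
have [t0 t'0] : (forall nu, 0 <= t nu) /\ (forall nu, 0 <= t' nu).
  by split=> nu; [have [] := tsr nu|have [] := tsr' nu].
have T0 nu : 0 <= T nu by rewrite addr_ge0 // mulr_ge0 // subr_ge0.
have aT nu : a nu * T nu = l * t nu.
  have [Tz|Tnz] := eqVneq (T nu) 0; last by rewrite divfK.
  rewrite Tz mulr0; have := t0 nu; have := t'0 nu; move: Tz; rewrite /T; nra.
have aT' nu : (1 - a nu) * T nu = (1 - l) * t' nu.
  by rewrite mulrBl aT mul1r /T addrC addKr.
have a01 nu : 0 < T nu -> 0 <= a nu <= 1.
  move=> Tp; rewrite divr_ge0 ?mulr_ge0 //= ler_pdivrMr // mul1r lerDl.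
  by rewrite mulr_ge0 // subr_ge0.
exists T, (fun nu => a nu *: s nu + (1 - a nu) *: s' nu),
  (fun nu => a nu * r nu + (1 - a nu) * r' nu); split.
  move=> nu; split=> // Tp; have an := a01 nu Tp.
  have [az|anz] := eqVneq (a nu) 0.
    rewrite az subr0 !scale0r !mul0r !add0r scale1r mul1r; apply: (tsr' nu).2.
    rewrite lt_def t'0 andbT; apply/eqP => t'z.
    by have := aT' nu; rewrite az t'z; lra.
  have [aone|an1] := eqVneq (a nu) 1.
    rewrite aone subrr !scale0r !mul0r !addr0 scale1r mul1r; apply: (tsr nu).2.
    rewrite lt_def t0 andbT; apply/eqP => tz.
    by have := aT nu; rewrite aone tz; lra.
  apply: robustly_better_conv => //; [apply: (tsr nu).2|apply: (tsr' nu).2].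
    rewrite lt_def t0 andbT; apply: contraNneq anz => tz.
    by rewrite /a tz mulr0 mul0r.
  rewrite lt_def t'0 andbT; apply: contraNneq an1 => tz.
  have := aT' nu; rewrite tz mulr0 => /eqP.
  by rewrite mulf_eq0 (gt_eqF Tp) orbF subr_eq0 => /eqP <-.
have -> : \sum_nu T nu * (a nu * r nu + (1 - a nu) * r' nu)
    = l * (\sum_nu t nu * r nu) + (1 - l) * (\sum_nu t' nu * r' nu).
  rewrite !mulr_sumr -big_split; apply: eq_bigr => nu _ /=.
  by rewrite !mulrA -aT -aT'; ring.
apply: (@le_lt_trans _ _
  (l * (\sum_nu `|y nu - x nu - t nu *: (s nu - x nu)|)
   + (1 - l) * (\sum_nu `|y' nu - x nu - t' nu *: (s' nu - x nu)|)));
     last first.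
  move: l0; rewrite le_eqVlt => /predU1P[<-|lp].
    by rewrite !mul0r !add0r subr0 !mul1r.
  by rewrite ltr_leD ?ltr_pM2l // ler_wpM2l ?subr_ge0 // ltW.
rewrite !mulr_sumr -big_split; apply: ler_sum => nu _ /=.
set u := y nu - x nu - t nu *: (s nu - x nu).
set u' := y' nu - x nu - t' nu *: (s' nu - x nu).
have -> : l * `|u| = `|l *: u| by rewrite normrZ ger0_norm.
have -> : (1 - l) * `|u'| = `|(1 - l) *: u'| by rewrite normrZ ger0_norm
  ?subr_ge0.
rewrite [X in `|X| <= _](_ : _ = l *: u + (1 - l) *: u') ?ler_normD //.
change ((l *: y + (1 - l) *: y') nu) with (l *: y nu + (1 - l) *: y' nu).
apply/rowP => j; rewrite !mxE.
have split_weights (p p' q : R) : T nu * (a nu * p + (1 - a nu) * p' - q)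
    = l * t nu * p + (1 - l) * t' nu * p' - (l * t nu + (1 - l) * t' nu) * q.
  by rewrite -aT -aT'; ring.
rewrite split_weights; ring.
Qed.

(** If [x] improved itself, for some player the ball of radius [r] around [s]
would contain [x nu], which is not better than itself. *)
Lemma improves_irreflexive x : ~ improves x x.
Proof.
move=> [t [s [r [tsr lt]]]].
have [nu tlt] : exists nu, `|x nu - x nu - t nu *: (s nu - x nu)| < t nu * r nu.
  apply: contrapT => none; move: lt; rewrite ltNge => /negP; apply.
  by apply: ler_sum => nu _; rewrite leNgt; apply/negP => h; apply: none;
    exists nu.
move: tlt; rewrite subrr sub0r normrN normrZ.
have [t0 better] := tsr nu; rewrite ger0_norm //.
move: t0; rewrite le_eqVlt => /predU1P[<-|tp]; first by rewrite !mul0r ltxx.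
rewrite ltr_pM2l // distrC => xs.
have [_ /nbhs_singleton /(_ _ xs)] := better tp.
by rewrite deviate_id ltxx.
Qed.

(** All the terms vanish: the deviating player reaches [s] exactly, and the
others do not move. *)
Lemma improves_deviate x nu (v : 'rV[R]_(d nu)) :
  theta nu (deviate x v) < theta nu x -> improves x (deviate x v).
Proof.
move=> /exists_robustly_better[r hr].
exists (fun mu => (mu == nu)%:R), (deviate x v), (fun=> r); split.
  move=> mu; split; first by rewrite ler0n.
  have [->|_] := eqVneq mu nu; last by rewrite ltxx.
  by move=> _; rewrite /deviate dfwithin.
rewrite big1 => [|mu _]; last first.
  have [->|ne] := eqVneq mu nu; first by rewrite scale1r subrr normr0.
  by rewrite scale0r subr0 /deviate dfwithout 1?eq_sym // subrr normr0.
rewrite (bigD1 nu) //= eqxx mul1r big1 ?addr0; first by case: hr.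
by move=> mu /negPf->; rewrite mul0r.
Qed.

Theorem equilibrium_compact (K : set E) :
  compact K -> K !=set0 -> convex_set K -> RGNEP theta K !=set0.
Proof.
move=> Kc K0 Kcv.
have [x Kx hx] := maximal_element Kc K0 Kcv improves_open improves_convex
  improves_irreflexive.
exists x; split=> // nu v Kv; rewrite leNgt; apply/negP => /improves_deviate.
exact: hx.
Qed.

End Equilibrium.

(** * Equilibria with a coercivity condition *)

Theorem theorem5p2 (R : realType) (N : finType) (hN : (0 < #|N|)%N)
    (d : N -> nat) (nrm : profile R d -> R) (hnrm : is_norm nrm)
    (X : set (profile R d)) (theta : N -> profile R d -> R)
    (Xconvex : convex_set X) (Xclosed : closed X) (Xneq0 : X !=set0)
    (theta_pc : forall nu : N, pseudo_continuous (theta nu))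
    (rho : R) (rho_gt0 : 0 < rho)
    (hi : X `&` cball nrm rho !=set0)
    (hii : forall x : profile R d, X x -> nrm x = rho ->
      exists2 y : profile R d, strategy_product X x y &
        forall nu : N, oball nrm rho (deviate x (y nu)) /\
          theta nu (deviate x (y nu)) <= theta nu x)
    (theta_ssqc : forall nu : N, own_semistrictly_quasi_convex nu (theta nu)) :
  RGNEP theta X !=set0.
Proof.
have Kc : compact (X `&` cball nrm rho).
  by rewrite setIC; apply: compact_closedI => //; exact: compact_cball.
have XcvP := (convex_setP X).1 Xconvex.
have bcvP := (convex_setP (cball nrm rho)).1 (@convex_cball R N d nrm hnrm rho).
have Kcv : convex_set (X `&` cball nrm rho).
  apply/convex_setP => x y t [Xx bx] [Xy by_] t01; split; first exact: XcvP.
  exact: bcvP.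
have [x [[Xx bx] xeq]] := equilibrium_compact theta_pc
  (fun nu x => (theta_ssqc nu x).1) Kc hi Kcv.
exists x; split=> // nu z Xz; rewrite leNgt; apply/negP => zlt.
(* A starting point strictly inside the ball which is no worse than [x nu]. *)
have [w [Xw wb wle]] : exists w : 'rV[R]_(d nu), [/\ X (deviate x w),
    nrm (deviate x w) < rho & theta nu (deviate x w) <= theta nu x].
  move: bx; rewrite /cball /= le_eqVlt => /predU1P[/(hii _ Xx)[y Xy hy]|bx].
    by have [wb wle] := hy nu; exists (y nu); split=> //; exact: Xy.
  by exists (x nu); rewrite deviate_id.
have xw : theta nu x <= theta nu (deviate x w).
  by apply: xeq; split=> //; exact: ltW.
set a := nrm (deviate x w) in wb; set b := nrm (deviate x z).
have [b0 a0] : 0 <= b /\ 0 <= a by split; exact: is_norm_ge0.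
(* Any [t] with [t * b <= rho - a] keeps the segment in the ball; the extra
   terms in the denominator make it positive and [t] smaller than 1. *)
pose t := (rho - a) / (rho + b + 1).
have den : 0 < rho + b + 1 by lra.
have t0 : 0 < t by rewrite divr_gt0 // subr_gt0.
have tden : t * (rho + b + 1) = rho - a by rewrite divfK ?gt_eqF.
have t1 : t < 1 by rewrite ltr_pdivrMr // mul1r; lra.
have t01 : 0 <= t <= 1 by rewrite !ltW.
have : theta nu (deviate x (t *: z + (1 - t) *: w)) < theta nu (deviate x w).
  by apply: (theta_ssqc nu x).2; rewrite ?t0 //; exact: lt_le_trans zlt xw.
rewrite ltNge (le_trans wle) //; apply: xeq; rewrite deviate_conv; split.
  exact: XcvP.
rewrite /cball /=; apply: le_trans (is_norm_triangle hnrm _ _) _.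
rewrite !(is_normZ hnrm) !ger0_norm ?subr_ge0 ?(ltW t0) ?(ltW t1) //.
by rewrite -/a -/b; nra.
Qed.
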